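(* Let $\mu$ be a compactly supported Borel probability measure on $\mathbb{R}^d$. (i) If $\mu$ is a doubling measure, then $\mu$ is quasi-doubling. (ii) If $\dim_{qA}\mu<\infty$, then $\mu$ is quasi-doubling.
   Context: $B(x,r)$ denotes the ball of centre $x$ and radius $r$. $\mu$ is doubling if there is a constant $c>0$ such that $\mu(B(x,r))\geq c\,\mu(B(x,2r))$ for every $x\in\operatorname{supp}\mu$ and every $r>0$. A compactly supported Borel probability measure $\mu$ is quasi-doubling if for every $\varepsilon>0$ and every positive, non-decreasing function $G(r)$ satisfying $\log G(r)/\log r\to0$ as $r\to0$, there exists $c>0$ such that $$\mu(B(x,G(r)r))\geq c\,r^\varepsilon\mu(B(x,2r))$$ for all $x\in\operatorname{supp}\mu$ and $r\in(0,1)$. For $\delta\ge0$ let $H(\delta)$ be the infimum of all $s$ for which there exist $C_1,C_2>0$ such that for all $0<r\leq R^{1+\delta}\leq R\leq C_1$, $\sup_{x\in\operatorname{supp}\mu}\frac{\mu(B(x,R))}{\mu(B(x,r))}\leq C_2(R/r)^s$. The quasi-Assouad dimension is $\dim_{qA}\mu=\lim_{\delta\to0}H(\delta)$. *)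

(* Defs.v *)
From HB Require Import structures.
From mathcomp Require Import all_boot all_order all_algebra.
From mathcomp Require Import all_classical all_reals all_analysis.

Set Implicit Arguments.
Unset Strict Implicit.
Unset Printing Implicit Defensive.

Import Order.TTheory GRing.Theory Num.Theory.
Import numFieldTopology.Exports numFieldNormedType.Exports.
Local Open Scope classical_set_scope.
Local Open Scope ring_scope.

(* R^d with its Borel sigma-algebra: the topology is the library's (product)
   topology on row vectors. *)
Notation borel_rV R d := (g_sigma_algebraType (@open 'rV[R]_d)).

(* The norm that the library puts on row vectors is the sup norm, so Euclidean
   balls have to be spelled out.  Balls are open. *)
Definition eball (R : realType) (d : nat) (x : 'rV[R]_d) (r : R)
    : set 'rV[R]_d :=
  [set y | Num.sqrt (\sum_(i < d) (y ord0 i - x ord0 i) ^+ 2) < r].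

Definition supp (R : realType) (d : nat) (mu : probability (borel_rV R d) R)
    : set 'rV[R]_d :=
  [set x | forall U : set 'rV[R]_d, open U -> U x -> (0 < mu U)%E].

Definition compactly_supported (R : realType) (d : nat)
    (mu : probability (borel_rV R d) R) : Prop :=
  compact (supp mu).

Definition doubling (R : realType) (d : nat)
    (mu : probability (borel_rV R d) R) : Prop :=
  exists2 c : R, 0 < c &
    forall (x : 'rV[R]_d) (r : R), supp mu x -> 0 < r ->
      (c%:E * mu (eball x (2 * r)) <= mu (eball x r))%E.

(* Only the values of G on (0,1) matter, hence positivity and monotonicity are
   required there only. *)
Definition quasi_doubling (R : realType) (d : nat)
    (mu : probability (borel_rV R d) R) : Prop :=
  forall (eps : R) (G : R -> R),
    0 < eps ->
    (forall r : R, 0 < r < 1 -> 0 < G r) ->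
    (forall r s : R, 0 < r -> r <= s -> s < 1 -> G r <= G s) ->
    ln (G r) / ln r @[r --> 0^'+] --> (0 : R) ->
    exists2 c : R, 0 < c &
      forall (x : 'rV[R]_d) (r : R), supp mu x -> 0 < r < 1 ->
        ((c * r `^ eps)%:E * mu (eball x (2 * r))
           <= mu (eball x (G r * r)))%E.

(* H(delta); its value is +oo when no exponent s is admissible. *)
Definition qA_exponent (R : realType) (d : nat)
    (mu : probability (borel_rV R d) R) (delta : R) : \bar R :=
  ereal_inf [set s%:E | s in [set s : R |
    exists C1 C2 : R, [/\ 0 < C1, 0 < C2 &
      forall r rho : R,
        0 < r -> r <= rho `^ (1 + delta) -> rho `^ (1 + delta) <= rho ->
        rho <= C1 ->
        (ereal_sup [set mu (eball x rho) / mu (eball x r) | x in supp mu]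
           <= (C2 * (rho / r) `^ s)%:E)%E]]].

(* The limit is one-sided and excludes delta = 0, so H(0) plays no role. *)
Definition dim_qA (R : realType) (d : nat)
    (mu : probability (borel_rV R d) R) : \bar R :=
  lim (qA_exponent mu delta @[delta --> 0^'+]).

(* Main.v *)
(** Both hypotheses yield polynomial growth of ball masses: for a fixed [s],
    [mu (B(x, rho)) <= C (rho / r)^s mu (B(x, r))] whenever
    [r <= rho^(1 + delta)] and [rho] is small, with [C] depending on [delta].
    For a doubling measure this is iterated doubling; if the quasi-Assouad
    dimension is finite, [H] is bounded on [(0, oo)], being nonincreasing.
    Since [G r >= r^delta] for small [r], taking [rho = 2 r] and radius
    [r^(1 + delta)] with [delta = eps / s] costs only a factor [r^eps].  For [r]
    bounded away from [0], [G r * r] is bounded below and compactness of the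
    support gives a uniform lower bound on the mass of balls of a fixed radius. *)

Require Import Defs.
From HB Require Import structures.
From mathcomp Require Import all_boot all_order all_algebra.
From mathcomp Require Import all_classical all_reals all_analysis.
From mathcomp Require Import ring lra.

Set Implicit Arguments.
Unset Strict Implicit.
Unset Printing Implicit Defensive.

Import numFieldTopology.Exports numFieldNormedType.Exports.
Import Order.TTheory GRing.Theory Num.Theory.

Local Open Scope classical_set_scope.
Local Open Scope ring_scope.

(** * Topology and measurability of Euclidean balls *)

Lemma cvg_edist (R : realType) (d : nat) (T : Type) (F : set_system T)
    {FF : Filter F} (f g : T -> 'rV[R]_d) (a b : 'rV[R]_d) :
  f z @[z --> F] --> a -> g z @[z --> F] --> b ->
  Num.sqrt (\sum_(i < d) (g z ord0 i - f z ord0 i) ^+ 2) @[z --> F]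
    --> Num.sqrt (\sum_(i < d) (b ord0 i - a ord0 i) ^+ 2).
Proof.
move=> fa gb; apply: (@continuous_cvg _ R R _ _ _ _ _ (@sqrt_continuous R _)).
apply: (@cvg_big R) => [|i _]; first exact: (@add_continuous R).
apply: (@continuous_cvg _ R R _ _ _ _ _ (@exprn_continuous R 2 _)).
by apply: (@cvgB _ R); apply: (@continuous_cvg _ 'rV[R]_d R _ _ _ _ _
  (@coord_continuous _ _ _ _ _ _)).
Qed.

(** Varying centre and point together yields one neighbourhood of [x0] inside all balls of radius
    [t] centred near [x0]. *)
Lemma near_eball (R : realType) (d : nat) (x0 : 'rV[R]_d) (t : R) : 0 < t ->
  \forall xy \near (x0, x0), eball xy.1 t xy.2.
Proof.
move=> t0.
pose dist (xy : 'rV[R]_d * 'rV[R]_d) :=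
  Num.sqrt (\sum_(i < d) (xy.2 ord0 i - xy.1 ord0 i) ^+ 2).
have D0 : dist xy @[xy --> (x0, x0)] -->
    Num.sqrt (\sum_(i < d) (x0 ord0 i - x0 ord0 i) ^+ 2).
  by apply: cvg_edist; [exact: cvg_fst|exact: cvg_snd].
apply: (cvgr_lt _ D0).
by rewrite big1 ?sqrtr0// => i _; rewrite subrr expr0n.
Qed.

Lemma open_eball (R : realType) (d : nat) (x : 'rV[R]_d) (r : R) :
  open (eball x r).
Proof.
suff nbhs_eball (y : 'rV[R]_d) : eball x r y -> nbhs y (eball x r).
  by rewrite openE => y /nbhs_eball.
move=> xry.
have D_cvg : Num.sqrt (\sum_(i < d) (z ord0 i - x ord0 i) ^+ 2) @[z --> y]
    --> Num.sqrt (\sum_(i < d) (y ord0 i - x ord0 i) ^+ 2).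
  by apply: (@cvg_edist R d _ (nbhs y) _ (fun=> x) id);
    [exact: cvg_cst|exact: cvg_id].
exact: (cvgr_lt _ D_cvg _ xry).
Qed.

Lemma eball_center (R : realType) (d : nat) (x : 'rV[R]_d) (r : R) :
  0 < r -> eball x r x.
Proof.
by move=> r0; rewrite /eball/= big1 ?sqrtr0// => i _; rewrite subrr expr0n.
Qed.

Lemma le_eball (R : realType) (d : nat) (x : 'rV[R]_d) (r t : R) :
  r <= t -> eball x r `<=` eball x t.
Proof. by move=> rt y /lt_le_trans; apply. Qed.

Lemma open_measurable_rV (R : realType) (d : nat) (A : set (borel_rV R d)) :
  open (A : set 'rV[R]_d) -> measurable A.
Proof. exact: sub_sigma_algebra. Qed.

Lemma measurable_eball (R : realType) (d : nat) (x : 'rV[R]_d) (r : R) :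
  measurable (eball x r : set (borel_rV R d)).
Proof. by apply: open_measurable_rV; exact: open_eball. Qed.

(** * Masses of balls as real numbers *)

Definition ball_mass (R : realType) (d : nat)
    (mu : probability (borel_rV R d) R) (x : 'rV[R]_d) (r : R) : R :=
  fine (mu (eball x r)).

Section ball_mass.
Context {R : realType} {d : nat} (mu : probability (borel_rV R d) R).
Implicit Types (x : 'rV[R]_d) (r t : R).

Lemma ball_massE x r : mu (eball x r) = (ball_mass mu x r)%:E.
Proof.
by rewrite /ball_mass fineK//; apply: fin_num_measure; exact: measurable_eball.
Qed.

Lemma ball_mass_ge0 x r : 0 <= ball_mass mu x r.
Proof. by rewrite -lee_fin -ball_massE. Qed.

Lemma ball_mass_le1 x r : ball_mass mu x r <= 1.
Proof.
rewrite -lee_fin -ball_massE; apply: probability_le1.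
exact: measurable_eball.
Qed.

Lemma le_ball_mass x r t : r <= t -> ball_mass mu x r <= ball_mass mu x t.
Proof.
move=> rt; rewrite -lee_fin -!ball_massE; apply: le_measure.
- apply/mem_set; exact: measurable_eball.
- apply/mem_set; exact: measurable_eball.
- exact: le_eball.
Qed.

Lemma ball_mass_gt0 x r : supp mu x -> 0 < r -> 0 < ball_mass mu x r.
Proof.
move=> sx r0; rewrite -lte_fin -ball_massE; apply: sx; first exact: open_eball.
exact: eball_center.
Qed.

(** Locally the bound is the mass of a neighbourhood contained in all nearby balls; compactness,
    applied along [c] tending to [0] from the right, makes it uniform. *)
Lemma ball_mass_lbound t : compactly_supported mu -> 0 < t ->
  exists2 c : R, 0 < c & forall x, supp mu x -> c <= ball_mass mu x t.
Proof.
move=> /compact_near_coveringP cpt t0.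
suff /filter_ex[c [c0 cm]] : \forall c \near 0^'+, 0 < c /\
    (supp mu `<=` [set x | c <= ball_mass mu x t]).
  by exists c.
apply: filterI; first exact: nbhs_right_gt.
have := cpt R 0^'+ (fun c x => c <= ball_mass mu x t) _; apply=> x0 sx0.
have [[U V]/= [Ux0 Vx0] UV] := near_eball x0 t0.
(* [V] itself may fail to be measurable; its interior is open and still contains [x0]. *)
have mV : measurable (V^° : set (borel_rV R d)).
  by apply: open_measurable_rV; exact: open_interior.
have V_gt0 : (0 < fine (mu V^°))%R.
  rewrite -lte_fin fineK; last exact: fin_num_measure.
  by apply: sx0 => //; exact: open_interior.
exists (U, [set c | c <= fine (mu V^°)]) => /=.
  by split=> //; exact: nbhs_right_ltW.
move=> [x c]/= [Ux cV]; apply: (le_trans cV).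
rewrite -lee_fin fineK -?ball_massE; last exact: fin_num_measure.
apply: le_measure.
- by apply/mem_set; exact: mV.
- apply/mem_set; exact: measurable_eball.
- by move=> y /interior_subset Vy; exact: (UV (x, y)).
Qed.

End ball_mass.

(** * Real powers and the gauge [G] near [0] *)

Lemma ler_powR_le1 (R : realType) (a x y : R) :
  0 < a <= 1 -> x <= y -> a `^ y <= a `^ x.
Proof.
move=> /andP[a0 a1] xy; rewrite -(subrK x y) powRD ?(gt_eqF a0) ?implybT//.
rewrite ler_piMl ?powR_ge0//; have <- : 1 `^ (y - x) = 1 by rewrite powR1.
by rewrite ge0_ler_powR ?nnegrE ?subr_ge0// ltW.
Qed.

Lemma powR1D (R : realType) (a x : R) : 0 < a -> a `^ (1 + x) = a * a `^ x.
Proof.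
by move=> a0; rewrite powRD ?(gt_eqF a0) ?implybT// powRr1 ?ltW.
Qed.

(** Since [ln r < 0], taking logarithms reduces the bound to [ln (G r) / ln r < eta]. *)
Lemma powR_le_near0 (R : realType) (G : R -> R) (eta : R) : 0 < eta ->
  (forall r : R, 0 < r < 1 -> 0 < G r) ->
  ln (G r) / ln r @[r --> 0^'+] --> (0 : R) ->
  exists2 t, 0 < t & forall r, 0 < r < t -> r `^ eta <= G r.
Proof.
move=> eta0 G0 lnG; suff [t/= t0 Gt] : \forall r \near 0^'+, r `^ eta <= G r.
  exists t => // r /andP[r0 rt]; apply: Gt => //=.
  by rewrite sub0r normrN gtr0_norm.
near=> r.
have r0 : 0 < r by near: r; exact: nbhs_right_gt.
have r1 : r < 1 by near: r; exact: nbhs_right_lt.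
have Gr0 : 0 < G r by apply: G0; rewrite r0.
rewrite -ler_ln ?posrE ?powR_gt0// ln_powR ltW//.
rewrite -ltr_ndivrMr ?ln_lt0 ?r0//.
by near: r; exact: (cvgr_lt _ lnG).
Unshelve. all: by end_near. Qed.

(* The content of [dim_qA mu < +oo]: the exponent [s] does not depend on
   [delta]. *)
Definition polynomial_growth (R : realType) (d : nat)
    (mu : probability (borel_rV R d) R) : Prop :=
  exists2 s : R, 0 < s & forall delta : R, 0 < delta ->
    exists C1 C2 : R, [/\ 0 < C1, 0 < C2 &
      forall x r rho, supp mu x -> 0 < r -> 0 < rho -> rho <= C1 ->
        r <= rho `^ (1 + delta) -> r <= rho ->
        ball_mass mu x rho <= C2 * (rho / r) `^ s * ball_mass mu x r].

(** * From polynomial growth to quasi-doubling *)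

Lemma polynomial_growth_quasi_doubling (R : realType) (d : nat)
    (mu : probability (borel_rV R d) R) :
  compactly_supported mu -> polynomial_growth mu -> quasi_doubling mu.
Proof.
move=> cpt [s s0 growth] eps G eps0 G0 G_ndecr lnG.
have [delta delta0 deltaE] : exists2 delta, 0 < delta & delta * s = eps.
  by exists (eps / s); rewrite ?divr_gt0// divfK// gt_eqF.
have [C1 [C2 [C10 C20 C12]]] := growth _ delta0.
have [t' t'0 t'G] := powR_le_near0 delta0 G0 lnG.
(* [2 * t <= C1] lets the growth bound apply at [rho = 2 * r] for [r < t]. *)
have [t [t0 t1 tC1 tG]] : exists t, [/\ 0 < t, t < 1, 2 * t <= C1 &
    forall r, 0 < r < t -> r `^ delta <= G r].
  exists (Num.min t' (Num.min (C1 / 2) (1 / 2))); split.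
  - by rewrite !lt_min t'0 !divr_gt0.
  - by rewrite !gt_min; apply/orP; right; apply/orP; right; lra.
  - by rewrite mulrC -ler_pdivlMr// !ge_min lexx orbT.
  - by move=> r /andP[r0]; rewrite lt_min => /andP[rt' _]; rewrite t'G ?r0.
have Gt0 : 0 < G t by rewrite G0// t0.
have [c c0 c_lb] := ball_mass_lbound cpt (mulr_gt0 Gt0 t0).
(* The inverse of the constant that the growth bound leaves at [rho = 2 * r]. *)
pose c' := (C2 * 2 `^ s)^-1.
have c'0 : 0 < c' by rewrite invr_gt0 mulr_gt0// powR_gt0.
exists (Num.min c c'); first by rewrite lt_min c0.
move=> x r sx /andP[r0 r1].
rewrite !ball_massE -EFinM lee_fin.
have reps1 : r `^ eps <= 1.
  by rewrite -(powRr0 r) ler_powR_le1 ?r0 ?ltW.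
(* For [t <= r], monotonicity gives [G t * t <= G r * r], so the compactness bound [c] suffices. *)
have [rt|tr] := ltP r t; last first.
  apply: (@le_trans _ _ c); last first.
    apply: le_trans (c_lb x sx) (le_ball_mass _ _ _).
    by rewrite ler_pM ?(ltW Gt0) ?(ltW t0)// G_ndecr.
  rewrite -[leRHS]mulr1 -mulrA ler_pM//.
  - by rewrite le_min !ltW.
  - by rewrite mulr_ge0 ?powR_ge0 ?ball_mass_ge0.
  - by rewrite ge_min lexx.
  - by rewrite mulr_ile1 ?powR_ge0 ?ball_mass_ge0 ?ball_mass_le1.
have rdelta1 : r `^ delta <= 1.
  by rewrite -(powRr0 r) ler_powR_le1 ?r0 ?ltW.
apply: (@le_trans _ _ (ball_mass mu x (r `^ (1 + delta)))); last first.
  by apply: le_ball_mass; rewrite powR1D// mulrC ler_pM2r// tG// r0.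
apply: (@le_trans _ _ (c' * r `^ eps * ball_mass mu x (2 * r))).
  rewrite !ler_wpM2r ?ball_mass_ge0 ?powR_ge0//.
  by rewrite ge_min lexx orbT.
have r1delta : r `^ (1 + delta) <= (2 * r) `^ (1 + delta).
  by apply: ge0_ler_powR; rewrite ?nnegrE; lra.
have r1delta_le : r `^ (1 + delta) <= 2 * r.
  by rewrite powR1D// mulrC ler_pM2r//; lra.
have r2C1 : 2 * r <= C1 by rewrite (le_trans _ tC1)// ler_pM2l// ltW.
have r2 : 0 < 2 * r by rewrite mulr_gt0.
have := C12 x _ (2 * r) sx (powR_gt0 _ r0) r2 r2C1 r1delta r1delta_le.
(* The loss is exactly [r^(-eps)] because [delta * s = eps]. *)
have -> : (2 * r / r `^ (1 + delta)) `^ s = 2 `^ s / r `^ eps.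
  have -> : 2 * r / r `^ (1 + delta) = 2 * r `^ (- delta).
    by rewrite powR1D// powRN; field; rewrite !gt_eqF ?powR_gt0.
  by rewrite powRM ?powR_ge0// -powRrM mulNr deltaE powRN.
move=> le_mass.
rewrite -mulrA ler_pdivrMl ?mulr_gt0 ?powR_gt0//.
rewrite -ler_pdivlMl ?powR_gt0// (le_trans le_mass)//.
by rewrite le_eqVlt; apply/orP; left; apply/eqP; field; rewrite !gt_eqF ?powR_gt0.
Qed.

(** * Doubling measures *)

Lemma doubling_polynomial_growth (R : realType) (d : nat)
    (mu : probability (borel_rV R d) R) :
  doubling mu -> polynomial_growth mu.
Proof.
move=> [c c0 double].
have [n cn] : exists n, c^-1 < 2 ^+ n.
  by exists (Num.Def.archi_bound c^-1); exact: upper_nthrootP.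
(* The successor keeps [s] positive even if [n = 0], and [c^-1 <= 2^s]. *)
pose s : R := n.+1%:R.
have s0 : 0 < s by rewrite ltr0n.
have double2 x r : supp mu x -> 0 < r ->
    ball_mass mu x (2 * r) <= 2 `^ s * ball_mass mu x r.
  move=> sx r0; have := double _ _ sx r0.
  rewrite !ball_massE -EFinM lee_fin -ler_pdivlMl//.
  move=> /le_trans; apply; rewrite ler_wpM2r ?ball_mass_ge0//.
  by rewrite powR_mulrn// exprS (le_trans (ltW cn))//
    ler_peMl// ?exprn_ge0// ler1n.
(* Induction on the number of halvings of [rho]: each costs [2^s], which is exactly what
   [(rho / r)^s] loses. The outer [2^s] pays for the last, incomplete step, so the constant is
   independent of [k]. *)
have iter_double x k : supp mu x -> forall r rho, 0 < r -> r <= rho ->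
    rho <= 2 ^+ k * r ->
    ball_mass mu x rho <= 2 `^ s * (rho / r) `^ s * ball_mass mu x r.
  move=> sx; elim: k => [|k IHk] r rho r0 r_rho rho_le.
    have -> : rho = r by apply/le_anti; rewrite r_rho -[leRHS]mul1r rho_le.
    rewrite divff ?gt_eqF// powR1 mulr1 ler_peMl ?ball_mass_ge0//.
    by rewrite powR_mulrn// exprn_ege1// ler1n.
  have [rho2|rho2] := leP rho (2 * r).
    apply: le_trans (le_ball_mass mu x rho2) _.
    apply: le_trans (double2 _ _ sx r0) _.
    rewrite ler_wpM2r ?ball_mass_ge0// ler_peMr ?powR_ge0//.
    by rewrite powR_mulrn ?divr_ge0// ?exprn_ege1 ?ler_pdivlMr ?mul1r//; lra.
  have rhoE : rho = 2 * (rho / 2) by field.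
  have rho20 : 0 < rho / 2 by lra.
  rewrite {1}rhoE; apply: le_trans (double2 _ _ sx rho20) _.
  rewrite -mulrA ler_wpM2l ?powR_ge0//.
  have -> : rho / r = 2 * (rho / 2 / r) by field; rewrite gt_eqF.
  rewrite powRM ?divr_ge0//; [|lra|lra].
  apply: IHk => //; first by lra.
  by move: rho_le; rewrite exprS -mulrA; lra.
exists s => // delta delta0; exists 1, (2 `^ s); split; rewrite ?powR_gt0//.
move=> x r rho sx r0 rho0 _ _ r_rho.
apply: (iter_double x (Num.Def.archi_bound (rho / r))) => //.
by rewrite -ler_pdivrMr// ltW// upper_nthrootP.
Qed.

(** * Finite quasi-Assouad dimension *)

(** For [rho <= 1] a larger [delta] constrains fewer radii [r], so every exponent admissible for
    [delta1] stays so for [delta2], once [C1] is cut down to at most [1]. *)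
Lemma qA_exponent_nonincreasing (R : realType) (d : nat)
    (mu : probability (borel_rV R d) R) (delta1 delta2 : R) :
  0 < delta1 -> delta1 <= delta2 ->
  (qA_exponent mu delta2 <= qA_exponent mu delta1)%E.
Proof.
move=> delta10 delta12; apply: ereal_inf_le_tmp.
move=> _ [s [C1 [C2 [C10 C20 C12]]] <-]; exists s => //.
exists (Num.min C1 1), C2; split=> //; first by rewrite lt_min C10 ltr01.
move=> r rho r0 r_rho rho_le; rewrite le_min => /andP[rhoC1 rho1].
have rho0 : 0 < rho.
  exact: lt_le_trans r0 (le_trans r_rho rho_le).
apply: C12 => //.
  by rewrite (le_trans r_rho)// ler_powR_le1 ?rho0// lerD2l.
by rewrite -[leRHS]powRr1 ?(ltW rho0)// ler_powR_le1 ?rho0//; lra.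
Qed.

(** By monotonicity the right limit at [0] is the supremum over positive [delta]. *)
Lemma qA_exponent_le_dim_qA (R : realType) (d : nat)
    (mu : probability (borel_rV R d) R) (delta : R) :
  0 < delta -> (qA_exponent mu delta <= dim_qA mu)%E.
Proof.
move=> delta0; rewrite /dim_qA.
have H_cvg := @nonincreasing_at_right_cvge R (qA_exponent mu) 0 +oo%O.
rewrite (cvg_lim _ (H_cvg _ _))//.
- by apply: ereal_sup_ubound; exists delta => //=; rewrite in_itv/= delta0.
- move=> d1 d2; rewrite !in_itv/= !andbT => d10 _.
  exact: qA_exponent_nonincreasing.
Qed.

(** A real [s] above the dimension exceeds every [H(delta)], so some admissible [s'] lies below [s];
    as [rho / r >= 1], it may be raised to [s]. *)
Lemma dim_qA_polynomial_growth (R : realType) (d : nat)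
    (mu : probability (borel_rV R d) R) :
  (dim_qA mu < +oo)%E -> polynomial_growth mu.
Proof.
move=> dim_lty.
have [s s0 dim_lts] : exists2 s : R, 0 < s & (dim_qA mu < s%:E)%E.
  case: (dim_qA mu) dim_lty => [a _||_] //.
    exists (`|a| + 1); first by rewrite ltr_wpDl.
    by rewrite lte_fin (le_lt_trans (ler_norm a))// ltrDl.
  by exists 1; rewrite ?ltNyr.
exists s => // delta delta0.
have /ereal_inf_lt[_ [s' [C1 [C2 [C10 C20 C12]]] <-]] :=
  le_lt_trans (qA_exponent_le_dim_qA mu delta0) dim_lts.
rewrite lte_fin => s's.
(* The cap [1] ensures [rho^(1 + delta) <= rho], as the definition of [H] demands. *)
exists (Num.min C1 1), C2; split=> //; first by rewrite lt_min C10 ltr01.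
move=> x r rho sx r0 rho0; rewrite le_min => /andP[rhoC1 rho1] r_rho1 r_rho.
have m0 := ball_mass_gt0 sx r0.
have rho1_rho : rho `^ (1 + delta) <= rho.
  by rewrite -[leRHS]powRr1 ?(ltW rho0)// ler_powR_le1 ?rho0//; lra.
have := C12 _ _ r0 r_rho1 rho1_rho rhoC1.
move=> /(le_trans (ereal_sup_ubound _)) => /(_ _ (ex_intro2 _ _ x sx erefl)).
(* The mass [m0] is positive, so the extended quotient is a real one. *)
rewrite !ball_massE inver gt_eqF// -EFinM lee_fin ler_pdivrMr//.
move=> /le_trans; apply; rewrite ler_wpM2r ?ball_mass_ge0// ler_wpM2l ?(ltW C20)//.
by rewrite ler_powR ?(ltW s's)// ler_pdivlMr// mul1r.
Qed.

Theorem proposition4p2 (R : realType) (d : nat)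
    (mu : probability (borel_rV R d) R)
    (mu_cpt : compactly_supported mu) :
  (doubling mu -> quasi_doubling mu) /\
  ((dim_qA mu < +oo)%E -> quasi_doubling mu).
Proof.
split=> [/doubling_polynomial_growth|/dim_qA_polynomial_growth];
  exact: polynomial_growth_quasi_doubling.
Qed.
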